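(* Let $R$ be a commutative ring with identity. Assume that $asr(R)=1$. Then the following properties hold: (1) Each triangular matrix in $Um(\mathbb{M}_2(R))$ is simply extendable. (2) (McGovern) If $R$ is a Hermite ring, then $R$ is an elementary divisor ring (EDR).
   Context: $Um(R^n)$ is the set of $n$-tuples in $R^n$ whose entries generate the unit ideal. A ring $S$ has stable range $1$, written $sr(S)=1$, if for each $(a,b)\in Um(S^2)$ there exists $r\in S$ such that $a+br$ is a unit. $J(R)$ is the Jacobson radical of $R$. $R$ has almost stable range $1$, written $asr(R)=1$, if for each ideal $I$ of $R$ not contained in $J(R)$, $sr(R/I)=1$. $\mathbb{M}_2(R)$ is the set of $2\times 2$ matrices with entries in $R$, and $Um(\mathbb{M}_2(R))$ is the set of those matrices in $\mathbb{M}_2(R)$ whose four entries generate the unit ideal. A matrix $A\in\mathbb{M}_2(R)$ is simply extendable if there exists a $3\times 3$ matrix $A^+$ with entries in $R$ and determinant $1$ whose upper-left $2\times 2$ block is $A$ and whose $(3,3)$ entry is $0$. $R$ is a Hermite ring (in the sense of Kaplansky) if $R\,Um(R^2)=R^2$, i.e., each pair in $R^2$ is of the form $r(a,b)$ with $r\in R$ and $(a,b)\in Um(R^2)$. An $m\times n$ matrix $B$ with entries in $R$ admits diagonal reduction if there exist $M\in GL_m(R)$ and $N\in GL_n(R)$ such that all off diagonal entries of $MBN$ are $0$ and its diagonal entries $b_{1,1},\ldots,b_{s,s}$, with $s=\min\{m,n\}$, are such that $b_{i,i}$ divides $b_{i+1,i+1}$ for all $i\in\{1,\ldots,s-1\}$.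 $R$ is an elementary divisor ring (EDR) if all matrices with entries in $R$ admit diagonal reduction. *)

(* Defs.v *)
From HB Require Import structures.
From mathcomp Require Import all_boot all_order all_algebra.

Set Implicit Arguments.
Unset Strict Implicit.
Unset Printing Implicit Defensive.

Import GRing.Theory.
Local Open Scope ring_scope.
Local Open Scope quotient_scope.

(* Rings are [comPzRingType]s, so that the zero ring is allowed, both as the
   base ring and as the quotient by the improper ideal.  The ideals and ring
   quotients of [ring_quotient] are restricted to nonzero rings and proper
   ideals, hence the variants below, which only reuse its quotient of additive
   groups. *)

HB.mixin Record isMulAbsorbing (R : comPzRingType) (S : R -> bool) := {
  mul_absorbing_subproof : forall a, {in S, forall u, a * u \in S}
}.

(* Membership is boolean, as everywhere in the library; classically this is no
   restriction on the ideals considered. *)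
#[short(type="ideal")]
HB.structure Definition Ideal (R : comPzRingType) :=
  {S of GRing.ZmodClosed R S & isMulAbsorbing R S}.

Lemma ideal_mulr (R : comPzRingType) (I : ideal R) a u : u \in I -> a * u \in I.
Proof. exact: mul_absorbing_subproof. Qed.

Module RingQuot.
Section RingQuot.
Variables (R : comPzRingType) (I : ideal R).

Definition quot : Type := Quotient.quot I.

#[export]
HB.instance Definition _ := EqQuotient.on quot.
#[export]
HB.instance Definition _ := GRing.Zmodule.on quot.

Local Notation Q := (Quotient.quot I).

Definition one : quot := \pi_Q 1.
Definition mul (x y : quot) : quot :=
  \pi_Q (repr (x : Q) * repr (y : Q)).

Lemma pi_mul (x y : R) : mul (\pi_Q x) (\pi_Q y) = \pi_Q (x * y).
Proof.
apply/eqP; rewrite /mul -Quotient.idealrBE.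
set x' := repr _; set y' := repr _.
have xI : x' - x \in I by rewrite Quotient.idealrBE reprK.
have yI : y' - y \in I by rewrite Quotient.idealrBE reprK.
have -> : x' * y' - x * y = x' * (y' - y) + y * (x' - x).
  by rewrite !mulrBr [y * x']mulrC [y * x]mulrC addrA subrK.
by rewrite rpredD ?ideal_mulr.
Qed.

Fact mulA : associative mul.
Proof.
move=> x y z; rewrite -[x](@reprK _ Q) -[y](@reprK _ Q) -[z](@reprK _ Q).
by rewrite !pi_mul mulrA.
Qed.

Fact mulC : commutative mul.
Proof. by move=> x y; rewrite /mul mulrC. Qed.

Fact mul1 : left_id one mul.
Proof. by move=> x; rewrite -[x](@reprK _ Q) pi_mul mul1r. Qed.

Fact mulDl : left_distributive mul +%R.
Proof.
move=> x y z; rewrite -[x](@reprK _ Q) -[y](@reprK _ Q) -[z](@reprK _ Q).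
by rewrite -[_ + _](raddfD (\pi_Q)) !pi_mul mulrDl raddfD.
Qed.

#[export]
HB.instance Definition _ :=
  GRing.Zmodule_isComPzRing.Build quot mulA mulC mul1 mulDl.

End RingQuot.
Module Exports. HB.reexport. End Exports.
End RingQuot.
Export RingQuot.Exports.

Notation ring_quot := RingQuot.quot.

(* For m = 1 this is Um(R^n), for m = n = 2 it is Um(M_2(R)). *)
Definition unimodular (R : comPzRingType) (m n : nat) (A : 'M[R]_(m, n)) : Prop :=
  exists C : 'M[R]_(m, n), \sum_i \sum_j C i j * A i j = 1.

(* [GRing.unit] is only available on rings with a decidable unit predicate. *)
Definition is_unit (R : comPzRingType) (x : R) : Prop := exists y, x * y = 1.

Definition stable_range1 (S : comPzRingType) : Prop :=
  forall v : 'rV[S]_2, unimodular v ->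
    exists r : S, is_unit (v ord0 ord0 + v ord0 ord_max * r).

Definition maximal_ideal (R : comPzRingType) (M : ideal R) : Prop :=
  1 \notin M /\
  forall I : ideal R, {subset M <= I} -> 1 \notin I -> {subset I <= M}.

Definition in_jacobson_radical (R : comPzRingType) (x : R) : Prop :=
  forall M : ideal R, maximal_ideal M -> x \in M.

Definition almost_stable_range1 (R : comPzRingType) : Prop :=
  forall I : ideal R, ~ (forall x, x \in I -> in_jacobson_radical x) ->
    stable_range1 (ring_quot I).

(* [is_trig_mx] means lower triangular. *)
Definition triangular (R : comPzRingType) (n : nat) (A : 'M[R]_n) : Prop :=
  is_trig_mx A \/ is_trig_mx A^T.

Definition simply_extendable (R : comPzRingType) (A : 'M[R]_2) : Prop :=
  exists B : 'M[R]_(2 + 1),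
    [/\ \det B = 1, ulsubmx B = A & B ord_max ord_max = 0].

Definition hermite_ring (R : comPzRingType) : Prop :=
  forall v : 'rV[R]_2, exists r : R, exists2 w : 'rV[R]_2, unimodular w & v = r *: w.

Definition invertible_mx (R : comPzRingType) (n : nat) (M : 'M[R]_n) : Prop :=
  exists N : 'M[R]_n, M *m N = 1%:M /\ N *m M = 1%:M.

(* The indices of a diagonal entry of a rectangular matrix live in two
   different ordinal types, and are compared as natural numbers. *)
Definition divisibility_diagonal (R : comPzRingType) (m n : nat)
    (D : 'M[R]_(m, n)) : Prop :=
  (forall (i : 'I_m) (j : 'I_n), (i : nat) <> j -> D i j = 0) /\
  (forall (i i' : 'I_m) (j j' : 'I_n),
     i = j :> nat -> i' = j' :> nat -> i' = i.+1 :> nat ->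
     exists c : R, D i' j' = c * D i j).

Definition admits_diagonal_reduction (R : comPzRingType) (m n : nat)
    (B : 'M[R]_(m, n)) : Prop :=
  exists (M : 'M[R]_m) (N : 'M[R]_n),
    [/\ invertible_mx M, invertible_mx N & divisibility_diagonal (M *m B *m N)].

Definition elementary_divisor_ring (R : comPzRingType) : Prop :=
  forall (m n : nat) (B : 'M[R]_(m, n)), admits_diagonal_reduction B.

(* Main.v *)
Require Import Defs.
From HB Require Import structures.
From mathcomp Require Import all_boot all_order all_algebra.
From mathcomp Require Import ring.
From mathcomp Require Import boolp classical_sets.

(** Both parts rest on one fact: over a ring [R] of almost stable range 1, a
triangular unimodular 2 x 2 matrix [A] represents 1, i.e., [x A y = 1] for some
row [x] and column [y] (lemma [asr1_bilinear]).  For [A] lower triangular with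
diagonal [a], [d] and corner [c] there are three cases.  If [a] is not in the
Jacobson radical, then [R/(a)] has stable range 1, so [c + d t] is a unit modulo
[a] for some [t], and [x = (u, v)], [y = (1, t)] work, where
[a u + (c + d t) v = 1].  If [d] is not in the Jacobson radical, the same
argument applies modulo [d].  If both are, then [c] is a unit.

Part (1): the determinant of the 3 x 3 matrix with upper-left block [A], last
column [(u, 0)] and last row [(v, 0)] is [- v adj(A) u], and up to the signs and
swaps that turn [adj(A)] into the transpose of [A] this is the form [x A y]
(lemma [simply_extendable_bilinear]).

Part (2): in a Hermite ring every row can be brought to the shape [(g, 0, .., 0)]
by an invertible column operation (lemma [hermite_row]).  Call a matrix
content-splitting if it is equivalent to [g B'] where the upper-left entry of
[B'] is 1; clearing the first row and column of [B'] then leaves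
[diag(g, g C)], and induction on the size applied to [C] gives the diagonal
reduction.  A 2 x 2 matrix is content-splitting: make it triangular, factor out
a greatest common divisor of its entries so that it becomes unimodular, and
complete the vectors [x] and [y] above to invertible matrices (lemma
[content_splits2]).  The general case is an induction on the number of rows
(lemma [content_splitsT]): once the matrix without its first row has been brought
to the shape [diag(g1, g1 C)] and the first row to [(b1, h, 0, .., 0)], all
entries are multiples of those of the upper-left 2 x 2 block. *)

Set Implicit Arguments.
Unset Strict Implicit.
Unset Printing Implicit Defensive.

Import GRing.Theory.
Local Open Scope ring_scope.

(** * Ideals, the Jacobson radical and stable range *)

Lemma ideal_of_Prop (R : comPzRingType) (P : R -> Prop) :
    P 0 -> (forall x y, P x -> P y -> P (x - y)) ->
    (forall a x, P x -> P (a * x)) ->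
  exists I : ideal R, forall x, x \in I <-> P x.
Proof.
move=> P0 PB PM; pose S : R -> bool := fun x => `[< P x >].
have zS : zmod_closed S.
  by split=> [|x y /asboolP Px /asboolP Py]; apply/asboolP; [|exact: PB].
have mS : forall a, {in S, forall u, a * u \in S}.
  by move=> a u /asboolP Pu; apply/asboolP/PM.
pose z := GRing.isZmodClosed.Build R S zS.
pose m := isMulAbsorbing.Build R S mS.
pose I : ideal R := HB.pack S z m.
by exists I => x; split=> [/asboolP|Px]; last exact/asboolP.
Qed.

Lemma principal_ideal_exists (R : comPzRingType) (a : R) :
  exists I : ideal R, forall x, x \in I <-> exists y, x = a * y.
Proof.
apply: ideal_of_Prop => [|x y [u ->] [v ->]|b x [u ->]].
- by exists 0; rewrite mulr0.
- by exists (u - v); rewrite mulrBr.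
- by exists (b * u); rewrite mulrCA.
Qed.

(** By Zorn's lemma.  The empty set is added to the poset of proper ideals
containing [c], so that the union of the empty chain stays in it. *)
Lemma nonunit_in_maximal_ideal (R : comPzRingType) (c : R) :
  ~ is_unit c -> exists2 M : ideal R, maximal_ideal M & c \in M.
Proof.
move=> cNu.
pose proper (A : set R) := [/\ A 0, forall x y, A x -> A y -> A (x - y),
  forall a x, A x -> A (a * x), A c & ~ A 1].
have [F sF totF|A [Agood Amax]] := @Zorn_bigcup R [set A | A = set0 \/ proper A].
  have [[X0 FX0 nX0]|F0] := pselect (exists2 X, F X & proper X); last first.
    left; rewrite -subset0 => x [X FX Xx].
    have [X0|pX] := sF _ FX; first by move: Xx; rewrite X0.
    by case: F0; exists X.
  have Fp X x : F X -> X x -> proper X.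
    by move=> FX Xx; have [X0'|//] := sF _ FX; move: Xx; rewrite X0'.
  right; have [z0 _ _ c0 _] := nX0; split.
  - by exists X0.
  - move=> x y [X FX Xx] [Y FY Yy].
    have [XY|YX] := totF _ _ FX FY.
      exists Y => //; have [_ B _ _ _] := Fp _ _ FY Yy.
      by apply: B => //; apply: XY.
    exists X => //; have [_ B _ _ _] := Fp _ _ FX Xx.
    by apply: B => //; apply: YX.
  - move=> a x [X FX Xx]; exists X => //.
    by have [_ _ M _ _] := Fp _ _ FX Xx; apply: M.
  - by exists X0.
  - by move=> [X FX X1]; have [_ _ _ _] := Fp _ _ FX X1.
pose C : set R := (fun x => exists y, x = c * y).
have pC : proper C.
  split=> [|x y [u ->] [v ->]|a x [u ->]||[y]].
  - by exists 0; rewrite mulr0.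
  - by exists (u - v); rewrite mulrBr.
  - by exists (a * u); rewrite mulrCA.
  - by exists 1; rewrite mulr1.
  - by move=> cy; apply: cNu; exists y.
have {Agood} [A0|[z B m Ac A1]] := Agood.
  case: (Amax C); last by right.
  rewrite A0; split=> [x []|C0]; have [_ _ _ Cc _] := pC; exact: (C0 _ Cc).
have [M eM] := ideal_of_Prop z B m.
exists M; last by apply/eM.
split=> [|I MI I1 x Ix]; first by apply/negP => /eM.
apply/eM; apply: contrapT => nAx.
case: (Amax (fun y => y \in I)).
  split=> [y /eM /MI //|sIA].
  by apply: nAx; apply: sIA.
right; split=> /=; [exact: rpred0|by move=> *; exact: rpredB| | |exact/negP].
- by move=> a y; apply: ideal_mulr.
- by apply: MI; apply/eM.
Qed.

(** If [c] is a unit modulo an element of the Jacobson radical, it is a unit. *)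
Lemma is_unit_jacobson (R : comPzRingType) (j c : R) :
  in_jacobson_radical j -> (exists p q, j * p + c * q = 1) -> is_unit c.
Proof.
move=> jJ [p [q e]]; apply: contrapT => /nonunit_in_maximal_ideal [M maxM cM].
have [/negP[]] := maxM; rewrite -e mulrC [c * q]mulrC.
by rewrite rpredD // ideal_mulr // jJ.
Qed.

Lemma in_jacobsonD (R : comPzRingType) (x y : R) :
  in_jacobson_radical x -> in_jacobson_radical y -> in_jacobson_radical (x + y).
Proof. by move=> xJ yJ M maxM; rewrite rpredD ?xJ ?yJ. Qed.

Lemma in_jacobsonM (R : comPzRingType) (a x : R) :
  in_jacobson_radical x -> in_jacobson_radical (a * x).
Proof. by move=> xJ M maxM; rewrite ideal_mulr ?xJ. Qed.

(** Stable range 1 of [R/(a)] applied to the class of [(c, d)], lifted to [R]. *)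
Lemma asr1_mod_principal (R : comPzRingType) (a c d p q s : R) :
    almost_stable_range1 R -> ~ in_jacobson_radical a ->
    p * a + q * c + s * d = 1 ->
  exists t u v, a * u + (c + d * t) * v = 1.
Proof.
move=> hR aJ e; have [I eI] := principal_ideal_exists a.
have aI : a \in I by apply/eI; exists 1; rewrite mulr1.
have /hR sr : ~ (forall x, x \in I -> in_jacobson_radical x) by move/(_ a aI).
pose Q := Quotient.quot I.
pose pr (x : R) : ring_quot I := \pi_Q%qT x.
have prM x y : pr x * pr y = pr (x * y) by exact: RingQuot.pi_mul.
have prD x y : pr x + pr y = pr (x + y) by rewrite /pr raddfD.
have pr_eq x y : pr x = pr y -> x - y \in I.
  by move=> exy; rewrite Quotient.idealrBE; apply/eqP.
have eq_pr x y : x - y \in I -> pr x = pr y.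
  by rewrite Quotient.idealrBE => /eqP.
have surj (x : ring_quot I) : exists y, x = pr y.
  by exists (repr (x : Q)); rewrite /pr reprK.
pose row2 (x y : R) : 'rV[ring_quot I]_2 :=
  \row_j (if j == ord0 then pr x else pr y).
have [|r [w]] := sr (row2 c d).
  exists (row2 q s); rewrite big_ord1 big_ord_recl big_ord1 !mxE /= !prM prD.
  apply: eq_pr; have -> : q * c + s * d - 1 = - p * a by rewrite -e; ring.
  exact: ideal_mulr.
have [t ->] := surj r; have [v ->] := surj w.
rewrite !mxE /= prM prD prM => /pr_eq /eI [u eu].
exists t, (- u), v; have -> : (c + d * t) * v = 1 + a * u by rewrite -eu; ring.
ring.
Qed.

(** A triangular unimodular 2 x 2 matrix with diagonal [a], [d] and corner [c]
represents 1. *)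
Lemma asr1_bilinear (R : comPzRingType) (a c d p q s : R) :
    almost_stable_range1 R -> p * a + q * c + s * d = 1 ->
  exists x1 x2 y1 y2 : R, x1 * a * y1 + x2 * c * y1 + x2 * d * y2 = 1.
Proof.
move=> hR e.
have [aJ|aJ] := pselect (in_jacobson_radical a); last first.
  have [t [u [v <-]]] := asr1_mod_principal hR aJ e.
  by exists u, v, 1, t; ring.
have [dJ|dJ] := pselect (in_jacobson_radical d); last first.
  have [|t [u [v <-]]] := @asr1_mod_principal R d c a s q p hR dJ.
    by rewrite -e; ring.
  by exists t, 1, v, u; ring.
have [||y <-] := @is_unit_jacobson R (p * a + s * d) c.
- by apply: in_jacobsonD; apply: in_jacobsonM.
- by exists 1, q; rewrite mulr1 -e; ring.
- by exists 0, 1, y, 0; ring.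
Qed.

(** * Invertible matrices *)

Section Invertible.
Variable R : comPzRingType.

Lemma invertible_mx1 n : invertible_mx (1%:M : 'M[R]_n).
Proof. by exists 1%:M; rewrite mulmx1. Qed.

Lemma invertible_mxM n (A B : 'M[R]_n) :
  invertible_mx A -> invertible_mx B -> invertible_mx (A *m B).
Proof.
move=> [A' [AA' A'A]] [B' [BB' B'B]]; exists (B' *m A'); split.
  by rewrite mulmxA -(mulmxA A) BB' mulmx1.
by rewrite mulmxA -(mulmxA B') A'A mulmx1.
Qed.

Lemma invertible_mx_tr n (A : 'M[R]_n) : invertible_mx A -> invertible_mx A^T.
Proof.
by move=> [A' [AA' A'A]]; exists A'^T; rewrite -!trmx_mul AA' A'A trmx1.
Qed.

Lemma invertible_block_diag m n (A : 'M[R]_m) (B : 'M[R]_n) :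
  invertible_mx A -> invertible_mx B -> invertible_mx (block_mx A 0 0 B).
Proof.
move=> [A' [AA' A'A]] [B' [BB' B'B]]; exists (block_mx A' 0 0 B').
rewrite !mulmx_block !mulmx0 !mul0mx !addr0 !add0r AA' A'A BB' B'B.
by rewrite -scalar_mx_block.
Qed.

Lemma invertible_lblock1 m n (C : 'M[R]_(m, n)) :
  invertible_mx (block_mx 1%:M 0 C 1%:M).
Proof.
exists (block_mx 1%:M 0 (- C) 1%:M).
rewrite !mulmx_block !mulmx0 !mul0mx !mul1mx !mulmx1 !addr0 !add0r subrr addNr.
by rewrite -scalar_mx_block.
Qed.

Lemma invertible_ublock1 m n (C : 'M[R]_(m, n)) :
  invertible_mx (block_mx 1%:M C 0 1%:M).
Proof.
have := invertible_mx_tr (invertible_lblock1 C^T).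
by rewrite tr_block_mx !trmx1 trmx0 trmxK.
Qed.

(** The 2 x 2 matrix with rows [(a, b)] and [(c, d)]. *)
Definition mx2 (a b c d : R) : 'M[R]_2 :=
  block_mx a%:M b%:M c%:M d%:M : 'M_(1 + 1).

Lemma mx2_eta (A : 'M[R]_2) :
  A = mx2 (A ord0 ord0) (A ord0 ord_max) (A ord_max ord0) (A ord_max ord_max).
Proof.
have e0 : lshift 1 (ord0 : 'I_1) = (ord0 : 'I_2) by apply: val_inj.
have e1 : rshift 1 (ord0 : 'I_1) = (ord_max : 'I_2) by apply: val_inj.
rewrite /mx2 -[LHS](@submxK _ 1 1 1 1) [ulsubmx _]mx11_scalar.
rewrite [ursubmx _]mx11_scalar [dlsubmx _]mx11_scalar [drsubmx _]mx11_scalar.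
by rewrite !mxE e0 e1.
Qed.

Lemma mx2M a b c d a' b' c' d' : mx2 a b c d *m mx2 a' b' c' d' =
  mx2 (a * a' + b * c') (a * b' + b * d') (c * a' + d * c') (c * b' + d * d').
Proof.
by rewrite /mx2 [LHS](@mulmx_block _ 1 1 1 1 1 1) -!scalar_mxM -!raddfD.
Qed.

Lemma mx2_00 a b c d : mx2 a b c d ord0 ord0 = a.
Proof.
have -> : (ord0 : 'I_2) = lshift 1 (ord0 : 'I_1) by apply: val_inj.
by rewrite [LHS]block_mxEul mxE.
Qed.

Lemma mx2_scale g a b c d :
  g *: mx2 a b c d = mx2 (g * a) (g * b) (g * c) (g * d).
Proof. by rewrite /mx2 [LHS](@scale_block_mx _ 1 1 1 1) !scale_scalar_mx. Qed.

Lemma invertible_mx2 a b c d : a * d - b * c = 1 -> invertible_mx (mx2 a b c d).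
Proof.
move=> e; exists (mx2 d (- b) (- c) a).
have e1 : mx2 1 0 0 1 = 1%:M by rewrite (scalar_mx_block 1 1) /mx2 raddf0.
rewrite !mx2M -e1; split; congr mx2; rewrite -?e; ring.
Qed.

(** * Row reduction over a Hermite ring *)

Lemma hermite_row2 (hH : hermite_ring R) (a b : R) :
  exists g w1 w2 u1 u2 : R, [/\ a = g * w1, b = g * w2 & w1 * u1 + w2 * u2 = 1].
Proof.
have [g [w [C Cw] e]] := hH (\row_j (if j == ord0 then a else b)).
exists g, (w ord0 ord0), (w ord0 ord_max), (C ord0 ord0), (C ord0 ord_max).
have /matrixP/(_ ord0 ord0) := e; have /matrixP/(_ ord0 ord_max) := e.
rewrite !mxE /= => -> ->; split=> //; rewrite -Cw.
rewrite big_ord1 big_ord_recl big_ord1 mulrC; congr (_ + _).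
rewrite mulrC; congr (C _ _ * w _ _); exact: val_inj.
Qed.

(** Induction on the length: reduce the tail, then the first two entries. *)
Lemma hermite_row (hH : hermite_ring R) n (v : 'rV[R]_(1 + n)) :
  exists2 Q : 'M[R]_(1 + n), invertible_mx Q &
  exists g : R, v *m Q = row_mx g%:M 0.
Proof.
elim: n v => [|n IHn] v.
  exists 1%:M; first exact: invertible_mx1.
  exists (lsubmx v ord0 ord0); rewrite mulmx1 -mx11_scalar -[LHS]hsubmxK.
  congr row_mx; exact: thinmx0.
have [Q' Q'inv [h eh]] := IHn (rsubmx (v : 'rV_(1 + (1 + n)))).
pose b := lsubmx (v : 'rV_(1 + (1 + n))) ord0 ord0.
have [g [w1 [w2 [u1 [u2 [ebg ehg e]]]]]] := hermite_row2 hH b h.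
pose N : 'M[R]_2 := mx2 u1 (- w2) u2 w1.
have Ninv : invertible_mx N by apply: invertible_mx2; rewrite -e; ring.
(* [Q'] reduces the tail of [v] to [(h, 0, .., 0)], and [N] maps [(b, h)] to
[(g, 0)]. *)
pose D1 : 'M[R]_(1 + n.+1) := block_mx 1%:M 0 0 Q'.
pose D2 : 'M[R]_(1 + n.+1) := (block_mx N 0 0 1%:M : 'M_((1 + 1) + n)).
exists (D1 *m D2).
  apply: invertible_mxM.
    by apply: invertible_block_diag => //; exact: invertible_mx1.
  by apply: (@invertible_block_diag 2 n) => //; exact: invertible_mx1.
exists g; rewrite mulmxA -[v](@hsubmxK _ _ 1) mul_row_block !mulmx0 addr0 add0r.
rewrite mulmx1 eh [lsubmx _]mx11_scalar -/b.
rewrite (@row_mxA _ 1 1 1 n) castmx_id /D2.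
rewrite [LHS](@mul_row_block _ 1 (1 + 1) n (1 + 1) n) !mulmx0 !mul0mx !addr0.
have -> : row_mx b%:M h%:M *m (N : 'M_(1 + 1)) = row_mx g%:M 0.
  rewrite /N /mx2 mul_row_block -!scalar_mxM -!raddfD /=; congr row_mx.
    by rewrite ebg ehg -!mulrA -mulrDr e mulr1.
  by rewrite ebg ehg -[RHS](raddf0 (@scalar_mx R 1)); congr (_%:M); ring.
transitivity (row_mx g%:M (row_mx 0 0 : 'rV[R]_(1 + n))).
  by rewrite (@row_mxA _ 1 1 1 n) castmx_id.
by rewrite row_mx0.
Qed.
End Invertible.

(** * Splitting off the content of a matrix *)

Section Reduction.
Variable R : comPzRingType.

(** [B] is equivalent to a multiple [g B'] of a matrix whose upper-left entry is
1; the ideal generated by the entries of [B] is then generated by [g]. *)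
Definition content_splits m n (B : 'M[R]_(1 + m, 1 + n)) : Prop :=
  exists M N g (B' : 'M[R]_(1 + m, 1 + n)),
    [/\ invertible_mx M, invertible_mx N, M *m B *m N = g *: B' &
        B' ord0 ord0 = 1].

Lemma content_splits_equiv m n M N (B : 'M[R]_(1 + m, 1 + n)) :
    invertible_mx M -> invertible_mx N ->
  content_splits (M *m B *m N) -> content_splits B.
Proof.
move=> Mi Ni [M' [N' [g [B' [M'i N'i e B'1]]]]].
exists (M' *m M), (N *m N'), g, B'; split=> //; [exact: invertible_mxM..|].
by rewrite -e !mulmxA.
Qed.

Lemma content_splits_tr m n (B : 'M[R]_(1 + m, 1 + n)) :
  content_splits B^T -> content_splits B.
Proof.
move=> [M [N [g [B' [Mi Ni e B'1]]]]]; exists N^T, M^T, g, B'^T.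
split; [exact: invertible_mx_tr..| |by rewrite mxE].
by rewrite -linearZ /= -e !trmx_mul trmxK mulmxA.
Qed.

(** The entry 1 of [B'] is used to clear the rest of its row and column. *)
Lemma content_splits_block m n (B : 'M[R]_(1 + m, 1 + n)) :
    content_splits B ->
  exists M N g (C : 'M[R]_(m, n)), [/\ invertible_mx M, invertible_mx N &
    M *m B *m N = block_mx g%:M 0 0 (g *: C)].
Proof.
move=> [M [N [g [B' [Mi Ni e B'1]]]]].
have ul1 : ulsubmx B' = 1%:M.
  by rewrite [LHS]mx11_scalar !mxE !lshift0 B'1.
move: e; rewrite -[B']submxK ul1.
move: (ursubmx B') (dlsubmx B') (drsubmx B') => r c d e.
exists (block_mx 1%:M 0 (- c) 1%:M *m M).
exists (N *m block_mx 1%:M (- r) 0 1%:M), g, (d - c *m r); split.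
- exact/invertible_mxM/Mi/invertible_lblock1.
- exact/invertible_mxM/invertible_ublock1.
rewrite mulmxA -(mulmxA _ M) -(mulmxA _ (M *m B)) e -scalemxAr -scalemxAl.
rewrite !mulmx_block !mulmx0 !mul0mx !mul1mx !mulmx1 !addr0 !addNr !mul0mx.
by rewrite scale_block_mx scalemx1 mul1mx addNr !scaler0 mulNmx add0r [- _ + _]addrC.
Qed.

(** * Diagonal reduction over a Hermite ring *)

(** Every lower triangular unimodular 2 x 2 matrix represents 1. *)
Definition triangular_bilinear :=
  forall a c d p q s : R, p * a + q * c + s * d = 1 ->
  exists x1 x2 y1 y2 : R, x1 * a * y1 + x2 * c * y1 + x2 * d * y2 = 1.

Hypothesis hT : triangular_bilinear.
Hypothesis hH : hermite_ring R.

Lemma content_splits2 (B : 'M[R]_(1 + 1, 1 + 1)) : content_splits B.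
Proof.
have [g [w1 [w2 [u1 [u2 [ea eb e]]]]]] :=
  hermite_row2 hH (B ord0 ord0) (B ord0 ord_max).
pose N : 'M[R]_2 := mx2 u1 (- w2) u2 w1.
have Ni : invertible_mx N by apply: invertible_mx2; rewrite -e; ring.
apply: (content_splits_equiv (invertible_mx1 R 2) Ni).
rewrite mul1mx [B]mx2_eta ea eb mx2M.
have -> : g * w1 * u1 + g * w2 * u2 = g by rewrite -!mulrA -mulrDr e mulr1.
have -> : g * w1 * - w2 + g * w2 * w1 = 0 by ring.
move: (B _ _ * u1 + _) (_ + B _ _ * w1) => c d.
(* The gcd [s] of [g], [c] and [d] is factored out. *)
have [r [a' [c' [p [q [-> -> e1]]]]]] := hermite_row2 hH g c.
have [s [r' [d' [p' [q' [-> -> e2]]]]]] := hermite_row2 hH r d.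
have [|x1 [x2 [y1 [y2 e3]]]] := @hT (r' * a') (r' * c') d' (p' * p) (p' * q) q'.
  by rewrite -[RHS]e2 -[r' * p']mulr1 -e1; ring.
(* The matrices complete the row [(x1, x2)] and the column [(y1, y2)]. *)
set a2 := r' * a' in e3; set c2 := r' * c' in e3.
exists (mx2 x1 x2 (- (c2 * y1 + d' * y2)) (a2 * y1)).
exists (mx2 y1 (- (x2 * d')) y2 (x1 * a2 + x2 * c2)), s.
eexists; split.
- by apply: invertible_mx2; rewrite -e3; ring.
- by apply: invertible_mx2; rewrite -e3; ring.
- have -> : mx2 (s * r' * a') 0 (s * r' * c') (s * d') = s *: mx2 a2 0 c2 d'.
    by rewrite mx2_scale mulr0 !mulrA.
  by rewrite -(@scalemxAr _ 2 2 2) -(@scalemxAl _ 2 2 2).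
- by rewrite (mx2M x1) mx2M mx2_00 -e3; ring.
Qed.

Lemma content_splits_row n (B : 'M[R]_(1 + 0, 1 + n)) : content_splits B.
Proof.
have [Q Qi [g e]] := hermite_row hH B.
exists 1%:M, Q, g, (row_mx 1%:M 0); split=> //; first exact: invertible_mx1.
  by rewrite mul1mx e scale_row_mx scaler0 scalemx1.
have -> : (ord0 : 'I_(1 + n)) = lshift n ord0 by apply: val_inj.
by rewrite row_mxEl mxE.
Qed.

(** Induction on the number of rows.  With the lower rows brought to
[diag(g1, g1 C)] and the first row to [(b1, h, 0, .., 0)], every entry is a
multiple of an entry of the upper-left 2 x 2 block [T], so it is enough to
reduce [T]. *)
Lemma content_splitsT m n (B : 'M[R]_(1 + m, 1 + n)) : content_splits B.
Proof.
elim: m n B => [|m IHm] n B; first exact: content_splits_row.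
case: n B => [|n] B; first by apply: content_splits_tr; exact: content_splits_row.
have [M1 [N1 [g1 [C [M1i N1i e1]]]]] :=
  content_splits_block (IHm n.+1 (dsubmx (B : 'M_(1 + (1 + m), 1 + n.+1)))).
pose b := usubmx (B : 'M_(1 + (1 + m), 1 + n.+1)) *m N1.
pose b1 := lsubmx b ord0 ord0.
have [Q Qi [h eh]] := hermite_row hH (rsubmx b : 'rV_(1 + n)).
pose c1 := lsubmx (C *m Q : 'M_(m, 1 + n)).
pose c2 := rsubmx (C *m Q : 'M_(m, 1 + n)).
pose M : 'M[R]_(1 + m.+1) := block_mx 1%:M 0 0 M1.
have Mi : invertible_mx M.
  by apply: invertible_block_diag => //; exact: invertible_mx1.
pose Q1 : 'M[R]_(1 + n.+1) := block_mx 1%:M 0 0 Q.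
have Q1i : invertible_mx Q1.
  by apply: invertible_block_diag => //; exact: invertible_mx1.
apply: (content_splits_equiv Mi (invertible_mxM N1i Q1i)).
pose T : 'M[R]_(1 + 1) := block_mx b1%:M h%:M g1%:M 0.
have -> : M *m B *m (N1 *m Q1) =
    (block_mx T 0 (g1 *: row_mx 0 c1) (g1 *: c2)
      : 'M_((1 + 1) + m, (1 + 1) + n)).
  transitivity (block_mx b1%:M (row_mx h%:M 0) (col_mx g1%:M 0)
     (block_mx 0 0 (g1 *: c1) (g1 *: c2))
       : 'M_(1 + (1 + m), 1 + (1 + n))); last first.
    by rewrite (@block_mxA _ 1 1 m 1 1 n) castmx_id scale_row_mx scaler0 col_mx0.
  have eM : M *m B = col_mx (usubmx (B : 'M_(1 + (1 + m), _)))
      (M1 *m dsubmx (B : 'M_(1 + (1 + m), _))).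
    rewrite -[in LHS](@vsubmxK _ 1 _ _ B) /M.
    rewrite (@mul_block_col _ 1 (1 + m) 1 (1 + m)).
    by rewrite !mul0mx mul1mx addr0 add0r.
  have eQ p (u : 'M[R]_(p, 1)) (v : 'M[R]_(p, 1 + n)) :
      row_mx u v *m (Q1 : 'M_(1 + (1 + n))) = row_mx u (v *m Q).
    by rewrite /Q1 mul_row_block !mulmx0 mulmx1 addr0 add0r.
  rewrite mulmxA eM (@mul_col_mx _ 1 (1 + m)) -/b e1.
  rewrite (@mul_col_mx _ 1 (1 + m)) -[b]hsubmxK.
  rewrite [lsubmx b]mx11_scalar -/b1 eQ eh block_mxEv mul_col_mx !eQ.
  rewrite mul0mx -scalemxAl -[C *m Q]hsubmxK -/c1 -/c2 scale_row_mx.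
  rewrite [RHS]block_mxEv; congr col_mx.
  by rewrite -block_mxEv block_mxEh [block_mx 0 0 _ _]block_mxEv row_mx0.
have [M2 [N2 [g [T' [M2i N2i e T'1]]]]] := content_splits2 T.
(* [g] divides every entry of [T], in particular [g1]. *)
have [k eg1] : exists k, g1 = g * k.
  have [M2' [_ M2K]] := M2i; have [N2' [N2K _]] := N2i.
  have eT : T = g *: (M2' *m T' *m N2').
    rewrite -[M2' *m T' *m N2']mul1mx scalemxAr.
    by rewrite mul1mx scalemxAl scalemxAr -e !mulmxA M2K mul1mx -mulmxA N2K mulmx1.
  exists ((M2' *m T' *m N2') (rshift 1 ord0) (lshift 1 ord0)).
  have /matrixP/(_ (rshift 1 ord0) (lshift 1 ord0)) := eT.
  by rewrite block_mxEdl !mxE.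
pose M3 : 'M[R]_(1 + m.+1) := (block_mx M2 0 0 1%:M : 'M_((1 + 1) + m)).
pose N3 : 'M[R]_(1 + n.+1) := (block_mx N2 0 0 1%:M : 'M_((1 + 1) + n)).
exists M3, N3, g.
exists (block_mx T' 0 (k *: (row_mx 0 c1 *m N2)) (k *: c2)
  : 'M_((1 + 1) + m, (1 + 1) + n)).
split.
- by apply: (@invertible_block_diag _ (1 + 1) m) => //; exact: invertible_mx1.
- by apply: (@invertible_block_diag _ (1 + 1) n) => //; exact: invertible_mx1.
- rewrite /M3 /N3 (@mulmx_block _ (1 + 1) m (1 + 1) m (1 + 1) n).
  rewrite [LHS](@mulmx_block _ (1 + 1) m (1 + 1) n (1 + 1) n).
  rewrite [RHS](@scale_block_mx _ (1 + 1) m (1 + 1) n).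
  rewrite !mulmx0 !mul0mx !mul1mx !mulmx1 !addr0 !add0r e.
  by rewrite scaler0 -scalemxAl !scalerA eg1.
- transitivity (T' ord0 ord0) => //.
  rewrite -[RHS](@block_mxEul _ (1 + 1) m (1 + 1) n _ 0
    (k *: (row_mx 0 c1 *m N2)) (k *: c2)).
  by congr (_ _ _); apply: val_inj.
Qed.

(** After splitting off [diag(g, g C)] the induction applies to [C], not to [g C],
so that [g] divides all the later diagonal entries. *)
Lemma diagonal_reduction m n (B : 'M[R]_(m, n)) : admits_diagonal_reduction B.
Proof.
elim: m n B => [|m IHm] n B.
  exists 1%:M, 1%:M; split; [exact: invertible_mx1..|].
  by split=> [[]|[]].
case: n B => [|n] B.
  exists 1%:M, 1%:M; split; [exact: invertible_mx1..|].
  by split=> [? []|? ? []].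
have [M [N [g [C [Mi Ni e]]]]] := content_splits_block (content_splitsT B).
have [M' [N' [M'i N'i [D0 Dd]]]] := IHm n C.
set D := M' *m C *m N' in D0 Dd.
exists (block_mx 1%:M 0 0 M' *m M), (N *m block_mx 1%:M 0 0 N').
split.
- apply: invertible_mxM Mi; apply: (@invertible_block_diag _ 1 m) => //.
  exact: invertible_mx1.
- apply: (invertible_mxM Ni); apply: (@invertible_block_diag _ 1 n) => //.
  exact: invertible_mx1.
have -> : block_mx 1%:M 0 0 M' *m M *m B *m (N *m block_mx 1%:M 0 0 N') =
    block_mx g%:M 0 0 (g *: D).
  rewrite mulmxA -(mulmxA _ M) -(mulmxA _ (M *m B)) e !mulmx_block.
  rewrite !mulmx0 !mul0mx !mul1mx !mulmx1 !addr0 !add0r.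
  by rewrite -scalemxAr -scalemxAl mul0mx.
clearbody D; split.
- move=> i j; case: (@split_ordP 1 m i) => {}i ->;
    case: (@split_ordP 1 n j) => {}j ->.
  + by rewrite !ord1.
  + by rewrite (@block_mxEur _ 1 m 1 n) mxE.
  + by rewrite (@block_mxEdl _ 1 m 1 n) mxE.
  + rewrite /= !add1n => ij.
    rewrite (@block_mxEdr _ 1 m 1 n) mxE D0 ?mulr0 // => ij'.
    by apply: ij; rewrite ij'.
- move=> i i' j j'; case: (@split_ordP 1 m i') => {}i' ->; first by rewrite ord1.
  case: (@split_ordP 1 n j') => {}j' ->; first by rewrite ord1 => _ /= ->.
  case: (@split_ordP 1 m i) => {}i ->; case: (@split_ordP 1 n j) => {}j ->.
  + move=> _ _ _; rewrite (@block_mxEdr _ 1 m 1 n) (@block_mxEul _ 1 m 1 n).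
    rewrite !ord1 !mxE; by exists (D i' j'); rewrite mulr1n mulrC.
  + by rewrite ord1.
  + by rewrite (ord1 j).
  + rewrite /= !add1n => -[ij] [ij'] [ii'].
    have [c ec] := Dd _ _ _ _ ij ij' ii'.
    by exists c; rewrite !(@block_mxEdr _ 1 m 1 n) !mxE ec mulrCA.
Qed.
End Reduction.

(** * Simple extensions *)

(** If [A] represents 1 as [x A y = 1], then [A] is simply extendable. *)
Lemma simply_extendable_bilinear (R : comPzRingType) (A : 'M[R]_2)
    (x1 x2 y1 y2 : R) :
    x1 * A ord0 ord0 * y1 + x1 * A ord0 ord_max * y2
    + x2 * A ord_max ord0 * y1 + x2 * A ord_max ord_max * y2 = 1 ->
  simply_extendable A.
Proof.
move=> e.
(* Up to sign, the last column is [x] with entries swapped, and the last row [y]. *)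
pose rows := [:: [:: A ord0 ord0; A ord0 ord_max; x2];
  [:: A ord_max ord0; A ord_max ord_max; - x1]; [:: - y2; y1; 0]].
pose B : 'M[R]_(2 + 1) := \matrix_(i, j) nth 0 (nth [::] rows i) j.
exists B; split; last by rewrite mxE.
  rewrite (expand_det_row _ ord0) !big_ord_recl big_ord0 /cofactor.
  rewrite !(expand_det_row _ ord0) !big_ord_recl !big_ord0 /cofactor !det_mx11.
  by rewrite !mxE /= /bump /= -[RHS]e; ring.
apply/matrixP => i j; rewrite !mxE /=.
have ord2 (k : 'I_2) : k = ord0 \/ k = ord_max.
  by case: k => [[|[|//]] ?]; [left|right]; apply: val_inj.
by case: (ord2 i) => ->; case: (ord2 j) => ->.
Qed.

(** The upper triangular case is the lower triangular one for the transpose, with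
the roles of [x] and [y] exchanged. *)
Lemma asr1_simply_extendable (R : comPzRingType) (A : 'M[R]_2) :
  almost_stable_range1 R -> triangular A -> unimodular A -> simply_extendable A.
Proof.
move=> hR tA [C]; rewrite !big_ord_recl !big_ord0 !addr0.
have -> : lift ord0 ord0 = ord_max :> 'I_2 by apply: val_inj.
case: tA => /is_trig_mxP tA.
  have A01 : A ord0 ord_max = 0 by apply: tA.
  rewrite A01 mulr0 addr0 addrA => /(asr1_bilinear hR) [x1 [x2 [y1 [y2 e]]]].
  by apply: (@simply_extendable_bilinear R A x1 x2 y1 y2); rewrite -e A01; ring.
have A10 : A ord_max ord0 = 0 by rewrite -(tA ord0 ord_max) // mxE.
rewrite A10 mulr0 add0r => /(asr1_bilinear hR) [x1 [x2 [y1 [y2 e]]]].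
by apply: (@simply_extendable_bilinear R A y1 y2 x1 x2); rewrite -e A10; ring.
Qed.

Theorem corollary1p9 (R : comPzRingType) (hR : almost_stable_range1 R) :
  (forall A : 'M[R]_2, triangular A -> unimodular A -> simply_extendable A) /\
  (hermite_ring R -> elementary_divisor_ring R).
Proof.
split=> [A|hH m n B]; first exact: asr1_simply_extendable.
by apply: diagonal_reduction hH _ _ B => a c d p q s; apply: asr1_bilinear.
Qed.
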